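(* Let $N,t$ be positive integers, let $\rho$ be an $N$-qubit state, and let $\{\boldsymbol u_k\mid k=1,\dots,L\}\subset S^2$ be a spherical $t$-design. Then the $t$-th moment of random correlations of $\rho$ satisfies $$\mathcal R^{(t)}=\frac1{L^N}\sum_{k_1,\dots,k_N=1}^{L}E(\boldsymbol u_{k_1},\dots,\boldsymbol u_{k_N})^t .$$
   Context: For a unit vector $\boldsymbol u\in S^2\subset\mathbb R^3$ let $\sigma_{\boldsymbol u}=u_x\sigma_x+u_y\sigma_y+u_z\sigma_z$ with the Pauli matrices. For an $N$-qubit state (density matrix on $(\mathbb C^2)^{\otimes N}$) $\rho$, the correlation function is $E(\boldsymbol u_1,\dots,\boldsymbol u_N)=\mathrm{tr}[\rho\,(\sigma_{\boldsymbol u_1}\otimes\dots\otimes\sigma_{\boldsymbol u_N})]$, and the $t$-th moment of random correlations is $$\mathcal R^{(t)}=\frac1{(4\pi)^N}\int_{S^2}d\boldsymbol u_1\cdots\int_{S^2}d\boldsymbol u_N\,E(\boldsymbol u_1,\dots,\boldsymbol u_N)^t,$$ where $d\boldsymbol u=\sin\theta\,d\theta\,d\phi$ is the surface measure on $S^2$ (total mass $4\pi$). A spherical $t$-design is a finite set of $L$ distinct points $\{\boldsymbol u_k\mid k=1,\dots,L\}\subset S^2$ such that $\frac1L\sum_{k=1}^{L}P(\boldsymbol u_k)=\frac1{4\pi}\int_{S^2}P(\boldsymbol u)\,d\boldsymbol u$ for all homogeneous polynomials $P:S^2\to\mathbb R$ (restrictions to $S^2$ of homogeneous polynomials in three real variables)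 of degree at most $t$. *)

(* Defs.v *)
From HB Require Import structures.
From mathcomp Require Import all_boot all_order all_algebra.
From mathcomp Require Import sesquilinear spectral.
From mathcomp Require Import -(notations) mpoly.
From mathcomp Require Import all_classical all_reals all_analysis.
From mathcomp Require Import complex mxtens.

Set Implicit Arguments.
Unset Strict Implicit.
Unset Printing Implicit Defensive.
Import Order.TTheory GRing.Theory Num.Theory.
Import numFieldNormedType.Exports.
Local Open Scope classical_set_scope.
Local Open Scope ring_scope.
Local Open Scope sesquilinear_scope.
Local Open Scope complex_scope.

(* [0 <= z] in [R[i]] says that [z] is real and nonnegative. *)
Definition density_matrix (R : realType) (n : nat) (rho : 'M[R[i]]_n) : Prop :=
  [/\ rho \is hermsymmx,
      forall v : 'rV[R[i]]_n, 0 <= (v *m rho *m v^t*) 0 0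
    & \tr rho = 1].

Definition mx22 (R : realType) (a b c d : R[i]) : 'M[R[i]]_2 :=
  \matrix_(i < 2, j < 2) [:: [:: a; b]`_j; [:: c; d]`_j]`_i.

Definition sigma_x (R : realType) : 'M[R[i]]_2 := mx22 0 1 1 0.
Definition sigma_y (R : realType) : 'M[R[i]]_2 := mx22 0 (- 'i) 'i 0.
Definition sigma_z (R : realType) : 'M[R[i]]_2 := mx22 1 0 0 (- 1).

(* In ['I_3] the numerals 0, 1, 2 are the three indices (the ring Z/3). *)
Definition pauli (R : realType) (u : 'rV[R]_3) : 'M[R[i]]_2 :=
  (u 0 0)%:C *: sigma_x R + (u 0 1)%:C *: sigma_y R + (u 0 2)%:C *: sigma_z R.

Fixpoint tensor (R : realType) (N : nat) :
    N.-tuple 'M[R[i]]_2 -> 'M[R[i]]_(2 ^ N) :=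
  match N with
  | 0 => fun=> 1%:M
  | n.+1 => fun A =>
      castmx (esym (expnS 2 n), esym (expnS 2 n))
             (thead A *t tensor (behead_tuple A))
  end.

Definition correlation (R : realType) (N : nat) (rho : 'M[R[i]]_(2 ^ N))
    (u : N.-tuple 'rV[R]_3) : R :=
  complex.Re (\tr (rho *m tensor (map_tuple (@pauli R) u))).

Lemma pauli_herm (R : realType) (u : 'rV[R]_3) : (pauli u)^t* = pauli u.
Proof.
apply/matrixP => i j; rewrite !mxE.
case: i => [[|[|//]] ?]; case: j => [[|[|//]] ?];
  apply/eqP; rewrite eq_complex /=;
  rewrite ?(mul0r, mulr0, mulr1, mulr1n, oppr0, add0r, addr0, mulrN, subr0,
            opprK, mulrN1) ?eqxx //.
Qed.

Lemma tensor_herm (R : realType) N (u : N.-tuple 'rV[R]_3) i j :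
  Num.conj (tensor (map_tuple (@pauli R) u) i j) =
    tensor (map_tuple (@pauli R) u) j i.
Proof.
elim: N u i j => [|n IH] u i j /=; first by rewrite !mxE eq_sym conjC_nat.
rewrite !castmxE !mxE rmorphM /=.
have -> : behead_tuple (map_tuple (@pauli R) u)
        = map_tuple (@pauli R) (behead_tuple u).
  by apply: val_inj => /=; rewrite behead_map.
rewrite IH; congr (_ * _).
have -> : thead (map_tuple (@pauli R) u) = pauli (thead u).
  by rewrite /thead tnth_map.
by rewrite -[in RHS]pauli_herm !mxE.
Qed.

(* The trace is real on states, so taking its real part loses nothing. *)
Lemma correlationE (R : realType) N (rho : 'M[R[i]]_(2 ^ N))
    (u : N.-tuple 'rV[R]_3) :
  density_matrix rho ->
  \tr (rho *m tensor (map_tuple (@pauli R) u)) = (correlation rho u)%:C.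
Proof.
move=> [/is_hermitianmxP]; rewrite expr0 scale1r => h _ _.
rewrite /correlation; set T := tensor _.
have: Num.conj (\tr (rho *m T)) = \tr (rho *m T).
  rewrite [RHS]mxtrace_mulC /mxtrace rmorph_sum; apply: eq_bigr => i _.
  rewrite !mxE rmorph_sum; apply: eq_bigr => k _.
  by rewrite rmorphM /= tensor_herm {1}h !mxE conjCK mulrC.
case: (\tr _) => a b /eqP; rewrite eq_complex /= eqxx /=.
by rewrite -subr_eq0 -opprD oppr_eq0 -mulr2n mulrn_eq0 /= => /eqP ->.
Qed.

Definition sphere2 (R : realType) : set 'rV[R]_3 :=
  [set u | \sum_(i < 3) u 0 i ^+ 2 = 1].

Definition sphere_point (R : realType) (theta phi : R) : 'rV[R]_3 :=
  \row_(i < 3) [:: sin theta * cos phi; sin theta * sin phi; cos theta]`_i.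

(* Integral for the surface measure [sin theta dtheta dphi]. *)
Definition sphere_int (R : realType) (f : 'rV[R]_3 -> R) : R :=
  \int[lebesgue_measure]_(phi in `[0, 2 * pi])
    \int[lebesgue_measure]_(theta in `[0, pi])
      (f (sphere_point theta phi) * sin theta).

(* [F] integrated over the product of [N] spheres, as an iterated integral whose
   outermost variable is the first one. *)
Fixpoint multi_sphere_int (R : realType) (N : nat) :
    (N.-tuple 'rV[R]_3 -> R) -> R :=
  match N with
  | 0 => fun F => F [tuple]
  | n.+1 => fun F =>
      sphere_int (fun u => multi_sphere_int (fun us => F [tuple of u :: us]))
  end.

Definition moment (R : realType) (N t : nat) (rho : 'M[R[i]]_(2 ^ N)) : R :=
  ((4 * pi) ^+ N)^-1 * multi_sphere_int (fun u => correlation rho u ^+ t).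

(* The case [d = 0], [P = 1] excludes [L = 0]. *)
Definition spherical_design (R : realType) (t L : nat)
    (u : 'I_L -> 'rV[R]_3) : Prop :=
  [/\ injective u,
      forall k, sphere2 (u k)
    & forall (d : nat) (P : mpoly 3 R), (d <= t)%N ->
        P \is ishomog1 d (@mdeg 3) ->
        L%:R^-1 * \sum_(k < L) meval (u k 0) P
        = (4 * pi)^-1 * sphere_int (fun v => meval (v 0) P)].

(* Main.v *)
(* The correlation function is linear in each of its N vectors, so its t-th
   power is a finite sum of products of N monomials of degree t, one for each
   vector. Both sides of the claim factor on such a product, and the design
   property at degree t identifies the factors one by one. *)
Require Import Defs.
From mathcomp Require Import all_boot all_order all_algebra.
From mathcomp Require Import -(notations) mpoly.
From mathcomp Require Import all_classical all_reals all_analysis.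
From mathcomp Require Import complex mxtens.
Local Open Scope ring_scope.
Import GRing.Theory numFieldNormedType.Exports.

(** * Integrals of finite sums and of continuous functions *)

Lemma Rintegral_sum {d} {T : measurableType d} {R : realType}
    (mu : {measure set T -> \bar R}) (D : set T) (I : Type) (s : seq I)
    (f : I -> T -> R) :
  measurable D ->
  (forall i, mu.-integrable D (EFin \o f i)) ->
  \int[mu]_(x in D) (\sum_(i <- s) f i x) =
  \sum_(i <- s) \int[mu]_(x in D) f i x.
Proof.
move=> mD fi; elim: s => [|a s IHs].
  rewrite big_nil; under eq_Rintegral do rewrite big_nil.
  by rewrite Rintegral_cst// mul0r.
rewrite big_cons -IHs -RintegralD//.
  by apply: eq_Rintegral => x _; rewrite big_cons.
(* What is left is integrability of the tail; [sumEFin] carries the sum of extended reals back to a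
   real sum. *)
have := @integrable_sum _ _ _ mu D mD I s xpredT (fun i => EFin \o f i)
  (fun i _ => fi i).
by congr (integrable _ _ _); apply/funext => x /=; rewrite sumEFin.
Qed.

Lemma continuous_prod (R : realType) (I : Type) (s : seq I) (f : I -> R -> R) :
  (forall i, continuous (f i)) -> continuous (fun x => \prod_(i <- s) f i x).
Proof.
move=> fc; elim: s => [|a s IHs] x.
  by under eq_fun do rewrite big_nil; exact: cvg_cst.
under eq_fun do rewrite big_cons.
by apply: cvgM; [exact: fc|exact: IHs].
Qed.

Lemma continuous_integrable_itv (R : realType) (a b : R) (f : R -> R) :
  continuous f -> lebesgue_measure.-integrable `[a, b]%classic (EFin \o f).
Proof.
move=> fc; apply: continuous_compact_integrable; first exact: segment_compact.
exact: continuous_subspaceT.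
Qed.

(** * Monomials in spherical coordinates *)

(** Each Cartesian coordinate on the sphere is a function of [theta] times a function of [phi]; this
    is the first factor, [azimuthal_factor] the second. Monomials therefore separate in the same
    way. *)
Definition polar_factor {R : realType} (a : 'I_3) : R -> R :=
  [:: sin; sin; cos]`_a.

Definition azimuthal_factor {R : realType} (a : 'I_3) : R -> R :=
  [:: cos; sin; fun=> 1]`_a.

Lemma sphere_pointE (R : realType) (theta phi : R) (a : 'I_3) :
  sphere_point theta phi 0 a = polar_factor a theta * azimuthal_factor a phi.
Proof.
by rewrite mxE /polar_factor /azimuthal_factor; case: a => [[|[|[|]]]] //= _;
  rewrite mulr1.
Qed.

Lemma continuous_polar_factor (R : realType) a :
  continuous (@polar_factor R a).
Proof.
rewrite /polar_factor; case: a => [[|[|[|]]]] //= _.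
- exact: continuous_sin.
- exact: continuous_sin.
- exact: continuous_cos.
Qed.

Lemma continuous_azimuthal_factor (R : realType) a :
  continuous (@azimuthal_factor R a).
Proof.
rewrite /azimuthal_factor; case: a => [[|[|[|]]]] //= _.
- exact: continuous_cos.
- exact: continuous_sin.
- exact: cst_continuous.
Qed.

(** Linearity of an iterated integral requires integrability at both levels. Separation of variables
    reduces this to continuity of one-variable functions on a segment. *)
Lemma sphere_int_separable (R : realType) (I : finType) (c : I -> R)
    (f : I -> 'rV[R]_3 -> R) (A B : I -> R -> R) :
  (forall i, continuous (A i)) -> (forall i, continuous (B i)) ->
  (forall i theta phi,
    f i (sphere_point theta phi) = A i theta * B i phi) ->
  sphere_int (fun v => \sum_i c i * f i v) = \sum_i c i * sphere_int (f i).
Proof.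
move=> Ac Bc fE.
have intA i : lebesgue_measure.-integrable `[0, pi]%classic
    (EFin \o (fun x => A i x * sin x)).
  apply: continuous_integrable_itv => x.
  by apply: cvgM; [exact: Ac|exact: continuous_sin].
have intB i k : lebesgue_measure.-integrable `[0, 2 * pi]%classic
    (EFin \o (fun x => k * B i x)).
  by apply: continuous_integrable_itv => x; apply: cvgM; [exact: cvg_cst|exact: Bc].
pose a i := \int[lebesgue_measure]_(x in `[0, pi]) (A i x * sin x).
(* The free constant [k] is 1 when a single [f i] is integrated and [c i] when the whole sum is. *)
have inner k i phi :
    \int[lebesgue_measure]_(theta in `[0, pi])
      (k * f i (sphere_point theta phi) * sin theta) = k * a i * B i phi.
  rewrite mulrAC -RintegralZl//; apply: eq_Rintegral => x _.
  by rewrite fE [A i x * _]mulrC !mulrA.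
have fint i : sphere_int (f i)
    = a i * \int[lebesgue_measure]_(x in `[0, 2 * pi]) B i x.
  rewrite -RintegralZl//; last exact: continuous_integrable_itv.
  apply: eq_Rintegral => phi _.
  rewrite -[a i]mul1r -inner; apply: eq_Rintegral => x _.
  by rewrite mul1r.
under [RHS]eq_bigr do
  rewrite fint mulrA -RintegralZl ?continuous_integrable_itv//.
rewrite -Rintegral_sum//; apply: eq_Rintegral => phi _.
under [RHS]eq_bigr do rewrite -inner.
rewrite -Rintegral_sum//.
  by apply: eq_Rintegral => x _; rewrite mulr_suml.
(* Integrability in [theta] at fixed [phi], where [B i phi] is a constant. *)
move=> i; apply: continuous_integrable_itv.
under eq_fun do rewrite fE.
move=> x; apply: cvgM; last exact: continuous_sin.
by apply: cvgM (cvg_cst _) _; apply: cvgM (cvg_cst _); exact: Ac.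
Qed.

Lemma sphere_int_sum_monomial (R : realType) (I : finType) (t : nat)
    (c : I -> R) (w : I -> 'I_t -> 'I_3) :
  sphere_int (fun v : 'rV[R]_3 => \sum_i c i * \prod_(j < t) v 0 (w i j)) =
  \sum_i c i * sphere_int (fun v => \prod_(j < t) v 0 (w i j)).
Proof.
apply: (sphere_int_separable _ _ _ (fun i v => \prod_(j < t) v 0 (w i j))
  (fun i x => \prod_(j < t) polar_factor (w i j) x)
  (fun i x => \prod_(j < t) azimuthal_factor (w i j) x)).
- by move=> i; apply: continuous_prod => j; exact: continuous_polar_factor.
- by move=> i; apply: continuous_prod => j; exact: continuous_azimuthal_factor.
- move=> i theta phi; rewrite -big_split /=.
  by apply: eq_bigr => j _; rewrite sphere_pointE.
Qed.

(** Induction on [N]. With the first vector fixed, its monomial joins the coefficients of the inner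
    integral, which is why [c] is arbitrary. *)
Lemma multi_sphere_int_sum_monomial (R : realType) (N t : nat) (I : finType)
    (c : I -> R) (w : I -> 'I_N -> 'I_t -> 'I_3) :
  multi_sphere_int (fun us : N.-tuple 'rV[R]_3 =>
    \sum_i c i * \prod_(n < N) \prod_(j < t) tnth us n 0 (w i n j)) =
  \sum_i c i *
    \prod_(n < N) sphere_int (fun v => \prod_(j < t) v 0 (w i n j)).
Proof.
elim: N c w => [|N IHN] c w /=.
  by apply: eq_bigr => i _; rewrite !big_ord0.
pose s i := \prod_(n < N)
  sphere_int (fun v : 'rV[R]_3 => \prod_(j < t) v 0 (w i (lift ord0 n) j)).
(* The inner integrals become the constants [s i], leaving a combination of monomials in the first
   vector. *)
rewrite (_ : (fun u => _) = fun u : 'rV[R]_3 =>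
    \sum_i c i * s i * \prod_(j < t) u 0 (w i ord0 j)); last first.
  apply/funext => u; under [RHS]eq_bigr do rewrite mulrAC.
  rewrite -IHN; congr multi_sphere_int; apply/funext => us.
  apply: eq_bigr => i _; rewrite big_ord_recl tnth0 mulrA.
  by congr (_ * _); apply: eq_bigr => n _; rewrite tnthS.
rewrite sphere_int_sum_monomial; apply: eq_bigr => i _.
by rewrite big_ord_recl -mulrA [s i * _]mulrC.
Qed.

(** A product of [t] variables is a homogeneous polynomial of degree [t], so the design property
    applies with [d = t]. *)
Lemma design_monomial (R : realType) (t L : nat) (u : 'I_L -> 'rV[R]_3)
    (w : 'I_t -> 'I_3) :
  spherical_design t u ->
  (4 * pi)^-1 * sphere_int (fun v => \prod_(j < t) v 0 (w j)) =
  L%:R^-1 * \sum_(k < L) \prod_(j < t) u k 0 (w j).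
Proof.
case=> _ _ /(_ t (\prod_(j < t) mpolyX R (mnm1 (w j))) (leqnn t)).
have mE (v : 'rV[R]_3) : meval (v 0) (\prod_(j < t) mpolyX R (mnm1 (w j))) =
    \prod_(j < t) v 0 (w j).
  by rewrite rmorph_prod /=; apply: eq_bigr => j _; rewrite mevalXU.
have -> : \prod_(j < t) mpolyX R (mnm1 (w j)) \is ishomog1 t (@mdeg 3).
  elim: t w {mE} => [|t IHt] w; first by rewrite big_ord0 dhomog1.
  rewrite big_ord_recl; apply: (dhomogM (d := 1) (e := t)); last exact: IHt.
  by rewrite dhomogX /= mdeg1.
move=> /(_ isT) H; rewrite (eq_bigr _ (fun k _ => esym (mE (u k)))) H.
by congr (_ * sphere_int _); apply/funext => v; rewrite mE.
Qed.

(** * Polynomial expansion of the correlation function *)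

Lemma pauliE (R : realType) (v : 'rV[R]_3) :
  pauli v = \sum_(a < 3) (v 0 a)%:C%C *:
    [:: sigma_x R; sigma_y R; sigma_z R]`_a.
Proof.
rewrite !big_ord_recl big_ord0 addr0 addrA.
have -> : lift ord0 (lift ord0 ord0) = 2 :> 'I_3 by exact: val_inj.
by have -> : lift ord0 ord0 = 1 :> 'I_3 by exact: val_inj.
Qed.

(** Expand every tensor factor in the three Pauli matrices: [G] encodes words of [N] letters in
    ['I_3], and [T g] is the tensor product of the Pauli matrices spelled by [g]. *)
Lemma tensor_pauli_multilinear (R : realType) (N : nat) :
  exists (G : finType) (f : G -> 'I_N -> 'I_3) (T : G -> 'M[R[i]]_(2 ^ N)),
  forall us : N.-tuple 'rV[R]_3, tensor (map_tuple (@pauli R) us) =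
    \sum_g (\prod_(n < N) tnth us n 0 (f g n))%:C%C *: T g.
Proof.
elim: N => [|N [G [f [T IHN]]]].
  exists unit, (fun _ _ => ord0), (fun=> 1%:M) => us /=.
  by rewrite big_const card_unit /= addr0 big_ord0 scale1r.
exists ('I_3 * G)%type,
  (* The new letter [g.1] belongs to position 0; the old word [g.2] is shifted by one. *)
  (fun g n => if unlift ord0 n is Some m then f g.2 m else g.1),
  (fun g : 'I_3 * G => castmx (esym (expnS 2 N), esym (expnS 2 N))
    ([:: sigma_x R; sigma_y R; sigma_z R]`_(g.1) *t T g.2)).
case/tupleP => u us.
have /= -> : behead_tuple (map_tuple (@pauli R) [tuple of u :: us])
    = map_tuple (@pauli R) us by exact: val_inj.
have -> : thead (map_tuple (@pauli R) [tuple of u :: us]) = pauli u.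
  by rewrite /thead tnth_map.
rewrite IHN pauliE; apply/matrixP => i j.
rewrite castmxE mxE !summxE mulr_suml.
under eq_bigr do rewrite mulr_sumr.
rewrite pair_bigA /=; apply: eq_bigr => -[a g] _ /=.
rewrite !mxE castmxE !mxE big_ord_recl tnth0 unlift_none rmorphM mulrACA.
congr (_ * _%:C%C * _).
by apply: eq_bigr => n _; rewrite tnthS liftK.
Qed.

Lemma correlation_multilinear (R : realType) (N : nat)
    (rho : 'M[R[i]]_(2 ^ N)) :
  exists (G : finType) (f : G -> 'I_N -> 'I_3) (c : G -> R),
  forall us : N.-tuple 'rV[R]_3, correlation rho us =
    \sum_g c g * \prod_(n < N) tnth us n 0 (f g n).
Proof.
have [G [f [T TE]]] := tensor_pauli_multilinear R N.
exists G, f, (fun g => complex.Re (\tr (rho *m T g))) => us.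
rewrite /correlation TE mulmx_sumr (raddf_sum (@mxtrace _ _)) raddf_sum /=.
apply: eq_bigr => g _; rewrite -scalemxAr mxtraceZ.
(* The scalar is real, so it comes out of the real part. *)
by case: (\tr _) => x y /=; rewrite mul0r subr0 mulrC.
Qed.

(** Expanding the power chooses one term from each of the [t] factors, hence the index set of
    functions from ['I_t]. Each factor is linear in each vector, so regrouping by vectors gives [t]
    coordinates of each. *)
Lemma correlation_exp (R : realType) (N t : nat) (rho : 'M[R[i]]_(2 ^ N)) :
  exists (G : finType) (w : G -> 'I_N -> 'I_t -> 'I_3) (c : G -> R),
  forall us : N.-tuple 'rV[R]_3, correlation rho us ^+ t =
    \sum_g c g * \prod_(n < N) \prod_(j < t) tnth us n 0 (w g n j).
Proof.
have [G [f [c corrE]]] := correlation_multilinear R N rho.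
exists {ffun 'I_t -> G}, (fun (g : {ffun 'I_t -> G}) n j => f (g j) n),
  (fun g : {ffun 'I_t -> G} => \prod_(j < t) c (g j)) => us.
rewrite corrE -[t in LHS]card_ord -prodr_const bigA_distr_bigA /=.
by apply: eq_bigr => g _; rewrite big_split /= exchange_big.
Qed.

Lemma sum_tuple_prod (R : comPzRingType) (N L : nat) (h : 'I_N -> 'I_L -> R) :
  \sum_(k : N.-tuple 'I_L) \prod_(n < N) h n (tnth k n) =
  \prod_(n < N) \sum_(l < L) h n l.
Proof.
rewrite bigA_distr_bigA (reindex (fun k : {ffun 'I_N -> 'I_L} => mktuple k)) /=.
  by apply: eq_bigr => k _; apply: eq_bigr => n _; rewrite tnth_mktuple.
(* Distributivity sums over finite functions, which correspond bijectively to tuples. *)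
apply: onW_bij; exists (fun k => [ffun n => tnth k n]) => k.
  by apply/ffunP => n; rewrite ffunE tnth_mktuple.
by apply: eq_from_tnth => n; rewrite tnth_mktuple ffunE.
Qed.

Theorem mainTheorem2 (R : realType) (N t L : nat) (rho : 'M[R[i]]_(2 ^ N))
    (u : 'I_L -> 'rV[R]_3) :
  (0 < N)%N -> (0 < t)%N ->
  density_matrix rho ->
  spherical_design t u ->
  moment t rho =
    (L%:R ^+ N)^-1 *
      \sum_(k : N.-tuple 'I_L) correlation rho (map_tuple u k) ^+ t.
Proof.
move=> _ _ _ design.
have [G [w [c corrE]]] := correlation_exp R N t rho.
rewrite /moment (funext corrE) multi_sphere_int_sum_monomial.
under [in RHS]eq_bigr do rewrite corrE.
(* Both sides are now sums over [g], compared term by term with the common coefficient [c g]. *)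
rewrite exchange_big !mulr_sumr; apply: eq_bigr => g _ /=.
rewrite -mulr_sumr mulrCA [RHS]mulrCA; congr (_ * _).
under [in RHS]eq_bigr do under eq_bigr do rewrite tnth_map.
rewrite (sum_tuple_prod R N L (fun n l => \prod_(j < t) u l 0 (w g n j))).
(* Spreading the normalizations over the product gives each vector its own factor [(4 * pi)^-1] or
   [L%:R^-1]. *)
have prodE (x : R) : x ^+ N = \prod_(n < N) x by rewrite prodr_const card_ord.
rewrite -!exprVn !prodE -!big_split /=; apply: eq_bigr => n _.
exact: design_monomial.
Qed.
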